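(* Let $k\ge 2$ and let $G$ be a connected $k$-uniform hypergraph (with at least one edge) with maximum degree $\Delta$, minimum degree $\delta$, spectral radius $\rho(G)$ and principal ratio $\gamma$. Then $$\gamma \ge \left(\frac{\Delta}{\delta}\right)^{\frac{1}{2(k-1)}}.$$ Moreover, if equality holds in this inequality, then $\rho(G)=\sqrt{\Delta\delta}$.
   Context: A $k$-uniform hypergraph $G$ has a finite vertex set $V(G)=\{1,\dots,n\}$ and a set $E(G)$ of edges, each of which is a set of exactly $k$ distinct vertices. The degree $d_i$ of a vertex $i$ is the number of edges containing $i$; $\Delta=\max_i d_i$, $\delta=\min_i d_i$. A path from $u$ to $v$ is an alternating sequence $v_0e_1v_1e_2\cdots v_{l-1}e_lv_l$ with $v_0=u$, $v_l=v$, where the vertices $v_0,\dots,v_l$ are distinct, the edges $e_1,\dots,e_l$ are distinct, and $v_{i-1},v_i\in e_i$ for $i=1,\dots,l$; $G$ is connected if there is a path between any two vertices. The adjacency tensor of $G$ is $\mathcal{A}_G=(a_{i_1\cdots i_k})$, of order $k$ and dimension $n$, with $a_{i_1\cdots i_k}=\frac{1}{(k-1)!}$ if $\{i_1,\dots,i_k\}\in E(G)$ and $a_{i_1\cdots i_k}=0$ otherwise. For $x\in\mathbb{C}^n$, $\mathcal{A}_Gx^{k-1}\in\mathbb{C}^n$ has $i$-th component $\sum_{i_2,\dots,i_k=1}^n a_{ii_2\cdots i_k}x_{i_2}\cdots x_{i_k}$. A number $\lambda\in\mathbb{C}$ is an eigenvalue of $\mathcal{A}_G$ with eigenvector $x\in\mathbb{C}^n\setminus\{0\}$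 if $\mathcal{A}_Gx^{k-1}=\lambda x^{[k-1]}$, where $x^{[k-1]}=(x_1^{k-1},\dots,x_n^{k-1})^{\mathrm T}$. The spectral radius $\rho(G)$ is the maximum modulus of the eigenvalues of $\mathcal{A}_G$. For $G$ connected, by the Perron–Frobenius theorem for nonnegative weakly irreducible tensors, $\rho(G)$ is an eigenvalue and there is a unique eigenvector $x=(x_1,\dots,x_n)^{\mathrm T}$ for $\rho(G)$ with all entries positive and $\sum_{i=1}^n x_i^k=1$; it is called the principal eigenvector of $G$. Write $x_{\max}=\max_i x_i$, $x_{\min}=\min_i x_i$. The principal ratio of $G$ is $\gamma=x_{\max}/x_{\min}$. *)

(* Defs.v *)
From HB Require Import structures.
From mathcomp Require Import all_boot all_order all_algebra.
From mathcomp Require Import complex.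
From mathcomp Require Import all_classical all_reals all_analysis.

Set Implicit Arguments.
Unset Strict Implicit.
Unset Printing Implicit Defensive.

Import Order.TTheory GRing.Theory Num.Theory.
Local Open Scope ring_scope.

Record hypergraph (k n : nat) := Hypergraph {
  edges : {set {set 'I_n}};
  edges_uniform : forall e, e \in edges -> #|e| = k }.

Section Hypergraphs.
Context (k n : nat).
Implicit Type G : hypergraph k n.

Definition degree G (i : 'I_n) : nat := #|[set e in edges G | i \in e]|.

Definition max_degree G : nat := (\max_(i < n) degree G i)%N.

(* Every degree is at most #|edges G|, so this default value does not affect
   the minimum as soon as n > 0. *)
Definition min_degree G : nat := \big[minn/#|edges G|]_(i < n) degree G i.

(* An alternating sequence u e_1 v_1 ... e_l v_l is encoded by its origin u and
   the list [:: (e_1, v_1); ...; (e_l, v_l)]; l = 0 is allowed. *)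
Fixpoint walk G (u : 'I_n) (p : seq ({set 'I_n} * 'I_n)) : bool :=
  if p is (e, v) :: p' then
    [&& e \in edges G, u \in e, v \in e & walk G v p']
  else true.

Definition hpath G (u v : 'I_n) (p : seq ({set 'I_n} * 'I_n)) : bool :=
  [&& walk G u p, uniq (u :: unzip2 p), uniq (unzip1 p)
    & last u (unzip2 p) == v].

Definition hconnected G : Prop := forall u v, exists p, hpath G u v p.

End Hypergraphs.

Definition tensor (F : Type) (k n : nat) := k.-tuple 'I_n -> F.

Section Tensors.
Context (F : fieldType) (m n : nat).
Implicit Types (T : tensor F m.+1 n) (x : 'cV[F]_n).

(* T x^m, for T of order m + 1 *)
Definition tensor_apply T x : 'cV[F]_n :=
  \col_i \sum_(t : m.-tuple 'I_n) T [tuple of i :: t] * \prod_(j <- t) x j 0.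

(* x^[m] *)
Definition entrywise_pow x : 'cV[F]_n := map_mx (fun a => a ^+ m) x.

Definition is_eigenpair T (lambda : F) x : Prop :=
  x != 0 /\ tensor_apply T x = lambda *: entrywise_pow x.

Definition is_eigenvalue T (lambda : F) : Prop :=
  exists x, is_eigenpair T lambda x.

End Tensors.

(* The order is written k.-1.+1, which is k whenever k > 0, so that
   tensor_apply is available. The set [set j in t] of entries of t can only be
   an edge if it has k elements, i.e. if the entries of t are distinct. *)
Definition adjacency_tensor (F : fieldType) (k n : nat) (G : hypergraph k n) :
    tensor F k.-1.+1 n :=
  fun t => if [set j in t] \in edges G then (k.-1)`!%:R^-1 else 0.

Section Spectrum.
Context (R : realType) (k n : nat).
Implicit Types (G : hypergraph k n) (x : 'cV[R]_n).
Local Open Scope complex_scope.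
Local Open Scope classical_set_scope.

Definition eigenvalue_moduli G : set R :=
  [set r | exists2 lambda : R[i],
             is_eigenvalue (adjacency_tensor R[i] G) lambda
           & `|lambda| = r%:C].

(* The supremum is a maximum: see spectral_radius_max. *)
Definition spectral_radius G : R := sup (eigenvalue_moduli G).

Definition principal_eigenvector G x : Prop :=
  [/\ is_eigenpair (adjacency_tensor R[i] G) (spectral_radius G)%:C
        (map_mx (real_complex R) x),
      forall i, 0 < x i 0
    & \sum_(i < n) x i 0 ^+ k = 1].

(* The default values 0 and vec_max x are harmless when n > 0 and all the
   entries of x are positive. *)
Definition vec_max x : R := \big[Num.max/0]_(i < n) x i 0.
Definition vec_min x : R := \big[Num.min/vec_max x]_(i < n) x i 0.

Definition principal_ratio x : R := vec_max x / vec_min x.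

Lemma has_ubound_eigenvalue_moduli G : has_ubound (eigenvalue_moduli G).
Proof.
pose T := adjacency_tensor R[i] G.
pose C : R[i] := \sum_(t : (k.-1).-tuple 'I_n * 'I_n) `|T [tuple of t.2 :: t.1]|.
exists (complex.Re C) => r [l [y [y0 Ty]] lr].
have [i0 yi0] : exists i0, y i0 0 != 0.
  apply/existsP; apply: contraNT y0; rewrite negb_exists => /forallP y0.
  apply/eqP/matrixP => i j; rewrite (ord1 j) mxE; apply/eqP.
  by move: (y0 i); rewrite negbK.
pose N j := complex.Re `|y j 0|.
have NE j : `|y j 0| = (N j)%:C by rewrite /N normc_def.
case: (@Order.TotalTheory.arg_maxP _ _ _ i0 xpredT N isT) => i _ imax.
have yimax j : `|y j 0| <= `|y i 0| by rewrite !NE lecR; exact: imax.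
have yi : 0 < `|y i 0| by apply: lt_le_trans (yimax i0); rewrite normr_gt0.
have := congr1 (fun z : 'cV[R[i]]_n => `|z i 0|) Ty.
rewrite !mxE normrM normrX lr => le1.
have : r%:C * `|y i 0| ^+ k.-1 <= C * `|y i 0| ^+ k.-1.
  rewrite -le1; apply: le_trans (ler_norm_sum _ _ _) _.
  apply: (@le_trans _ _ (\sum_(t : (k.-1).-tuple 'I_n)
      `|T [tuple of i :: t]| * `|y i 0| ^+ k.-1)).
    apply: ler_sum => t _; rewrite normrM ler_wpM2l// normr_prod.
    rewrite -[in leRHS](size_tuple t).
    elim: (tval t) => [|j s IHs]; first by rewrite big_nil expr0.
    by rewrite big_cons exprS ler_pM ?prodr_ge0.
  rewrite -mulr_suml ler_wpM2r ?exprn_ge0 ?normr_ge0//.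
  rewrite /C -(pair_big xpredT xpredT
    (fun (t : (k.-1).-tuple 'I_n) j => `|T [tuple of j :: t]|))/=.
  apply: ler_sum => t _; rewrite (bigD1 i)//= lerDl.
  by apply: sumr_ge0.
by rewrite ler_pM2r ?exprn_gt0// lecE => /andP[_].
Qed.

Lemma spectral_radius_max G x : principal_eigenvector G x ->
  eigenvalue_moduli G (spectral_radius G) /\
  ubound (eigenvalue_moduli G) (spectral_radius G).
Proof.
case=> ev x_gt0 x_norm; have ub := has_ubound_eigenvalue_moduli G.
have mod : eigenvalue_moduli G `|spectral_radius G|.
  exists (spectral_radius G)%:C; first by exists (map_mx (real_complex R) x).
  by rewrite normc_def/= expr0n/= addr0 sqrtr_sqr.
have rho_ge0 : 0 <= spectral_radius G.
  by apply: le_trans (normr_ge0 _) _; exact: ub_le_sup mod.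
split; last by move=> r; exact: ub_le_sup.
by move: mod; rewrite ger0_norm.
Qed.

End Spectrum.

(* Main.v *)
Require Import Defs.
From HB Require Import structures.
From mathcomp Require Import all_boot all_order all_algebra.
From mathcomp Require Import complex.
From mathcomp Require Import all_classical all_reals all_analysis.

(** The principal eigenvector x satisfies, at every vertex i,
      rho * x_i^(k-1) = sum over the edges e containing i of the product of
      the x_j for j in e other than i,
    a sum of d_i products of k - 1 entries of x, each product lying between
    x_min^(k-1) and x_max^(k-1). Bounding x_i itself by x_max on one side and
    by x_min on the other gives, with g = gamma^(k-1),
      d_i <= rho * g   and   rho <= d_i * g   for every i
    ([eigenvalue_row_sum_bounds]). The first bound at a vertex of
    maximum degree and the second at a vertex of minimum degree combine to
    Delta <= delta * g^2, which is the inequality. If equality holds then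
    g^2 = Delta / delta, so Delta <= rho * g and rho <= delta * g become, after
    squaring, Delta * delta <= rho^2 and rho^2 <= Delta * delta.

    The number d_i enters as the i-th row sum of the adjacency tensor: an edge
    containing i is listed by (k-1)! tuples starting with i, which the weight
    1 / (k-1)! compensates ([adjacency_row_sum]). *)

Set Implicit Arguments.
Unset Strict Implicit.
Unset Printing Implicit Defensive.

Import Order.TTheory GRing.Theory Num.Theory.
Local Open Scope ring_scope.

(** * Row sums of tensors *)

Definition row_sum (F : fieldType) (m n : nat) (T : tensor F m.+1 n) (i : 'I_n)
  : F := \sum_(t : m.-tuple 'I_n) T [tuple of i :: t].

Lemma tensor_apply_bounds (R : realFieldType) (m n : nat) (T : tensor R m.+1 n)
    (x : 'cV[R]_n) (a b : R) (i : 'I_n) :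
  (forall t, 0 <= T t) -> 0 <= a -> (forall j, a <= x j 0 <= b) ->
  row_sum T i * a ^+ m <= tensor_apply T x i 0 <= row_sum T i * b ^+ m.
Proof.
move=> T0 a0 xab.
have prodE c (t : m.-tuple 'I_n) : c ^+ m = \prod_(j <- t) c.
  by rewrite big_const_seq count_predT size_tuple -Monoid.iteropE.
rewrite /row_sum mxE !mulr_suml; apply/andP; split;
  apply: ler_sum => t _; apply: ler_wpM2l => //; rewrite (prodE _ _ t);
  apply: ler_prod => j _; have /andP[ax xb] := xab j.
- by rewrite a0 ax.
- by rewrite xb (le_trans a0 ax).
Qed.

(** With [r] the i-th row sum, the i-th entry [lambda * x i 0 ^+ m] of the
    eigenvalue equation lies between [r * a ^+ m] and [r * b ^+ m]; the lower
    bound is then weakened by [x i 0 <= b], the upper one by [a <= x i 0]. *)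
Lemma eigenvalue_row_sum_bounds (R : realFieldType) (m n : nat)
    (T : tensor R m.+1 n) (lambda : R) (x : 'cV[R]_n) (a b : R) (i : 'I_n) :
  (forall t, 0 <= T t) -> 0 < a -> (forall j, a <= x j 0 <= b) ->
  0 <= lambda -> is_eigenpair T lambda x ->
  row_sum T i <= lambda * (b / a) ^+ m /\
  lambda <= row_sum T i * (b / a) ^+ m.
Proof.
move=> T0 a0 xab l0 [_ Tx].
have /andP[ax xb] := xab i; have x0 := lt_le_trans a0 ax.
have /andP[lo hi] := tensor_apply_bounds i T0 (ltW a0) xab.
move: lo hi; rewrite Tx !mxE => lo hi.
rewrite exprMn exprVn !mulrA !ler_pdivlMr ?exprn_gt0//; split.
- apply: le_trans lo _; apply: ler_wpM2l => //.
  by apply: lerXn2r; rewrite ?nnegrE ?(ltW x0) ?(le_trans (ltW x0) xb).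
- apply: le_trans hi; apply: ler_wpM2l => //.
  by apply: lerXn2r; rewrite ?nnegrE ?(ltW x0) ?(ltW a0).
Qed.

(** The principal eigenvector is specified over the complex numbers; taking [f]
    to be the embedding of the reals brings its equation back to an ordered
    field. *)
Lemma is_eigenpair_map (F F' : fieldType) (f : {rmorphism F -> F'})
    (m n : nat) (T : tensor F m.+1 n) (lambda : F) (x : 'cV[F]_n) :
  is_eigenpair (fun t => f (T t)) (f lambda) (map_mx f x) ->
  is_eigenpair T lambda x.
Proof.
case=> x0 Tx; split; first by rewrite -(map_mx_eq0 f).
apply/colP => i; apply: (fmorph_inj f).
move/colP: Tx => /(_ i); rewrite !mxE rmorphM rmorphXn => <-.
rewrite rmorph_sum; apply: eq_bigr => t _.
rewrite rmorphM rmorph_prod; congr (_ * _).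
by apply: eq_bigr => j _; rewrite mxE.
Qed.

(** * The adjacency tensor *)

Lemma adjacency_tensor_map (F F' : fieldType) (f : {rmorphism F -> F'})
    (k n : nat) (G : hypergraph k n) :
  (fun t => f (adjacency_tensor F G t)) = adjacency_tensor F' G.
Proof.
apply/funext => t; rewrite /adjacency_tensor.
by case: ifP => _; rewrite ?rmorph0// fmorphV rmorph_nat.
Qed.

Lemma adjacency_tensor_ge0 (R : realFieldType) (k n : nat)
    (G : hypergraph k n) t : 0 <= adjacency_tensor R G t.
Proof. by rewrite /adjacency_tensor; case: ifP. Qed.

(** Such a tuple has as many entries as there are elements to list, so it
    enumerates [e :\ i] without repetition. *)
Lemma card_tuples_spanning (T : finType) (m : nat) (e : {set T}) (i : T) :
  i \in e -> #|e| = m.+1 ->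
  #|[set t : m.-tuple T | [set j in i :: t] == e]| = m`!.
Proof.
move=> ie ce.
have ce1 : #|e :\ i| = m by move: ce; rewrite (cardsD1 i) ie => -[].
have <- : #|e :\ i| ^_ m = m`! by rewrite ce1 ffactnn.
rewrite -(card_uniq_tuples _ (mem (e :\ i))); apply: eq_card => t; rewrite !inE.
have st : size (i :: t) = m.+1 by rewrite /= size_tuple.
apply/eqP/andP => [te|[/allP te ut]].
- have : uniq (i :: t) by apply/card_uniqP; rewrite st -ce -te cardsE.
  rewrite cons_uniq => /andP[it ut]; split=> //.
  apply/allP => j jt; rewrite !inE -te !inE jt orbT andbT.
  by apply: contraNneq it => <-.
- apply/eqP; rewrite eqEcard cardsE ce -st; apply/andP; split.
    apply/fintype.subsetP => j; rewrite !inE => /orP[/eqP->//|/te].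
    by rewrite !inE => /andP[].
  rewrite (card_uniqP _)// cons_uniq ut andbT.
  by apply/negP => /te; rewrite !inE eqxx.
Qed.

Lemma adjacency_row_sum (F : numFieldType) (k n : nat) (G : hypergraph k n)
    (i : 'I_n) : row_sum (adjacency_tensor F G) i = (degree G i)%:R.
Proof.
rewrite /row_sum /adjacency_tensor -big_mkcond/=.
(* Sort the tuples by the edge that they span together with i. *)
rewrite (partition_big (fun t : k.-1.-tuple 'I_n => [set j in i :: t])
  [pred e | e \in [set e in edges G | i \in e]])/=; last first.
  by move=> t tG; rewrite inE tG inE mem_head.
rewrite -sumr_const; apply: eq_bigr => e; rewrite inE => /andP[eG ie].
have k0 : (0 < k)%N.
  by rewrite -(edges_uniform eG) card_gt0; apply/finset.set0Pn; exists i.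
rewrite (eq_bigl (mem [set t : k.-1.-tuple 'I_n | [set j in i :: t] == e])).
  rewrite sumr_const card_tuples_spanning ?prednK ?(edges_uniform eG)//.
  by rewrite -[LHS]mulr_natr mulVf// pnatr_eq0 -lt0n fact_gt0.
move=> t; rewrite [RHS]inE; apply: andb_idl => /eqP te.
by rewrite (_ : [set j in [tuple of i :: t]] = e).
Qed.

(** * Extreme degrees and entries *)

Lemma max_degree_attained (k n : nat) (G : hypergraph k n) :
  (0 < n)%N -> exists i, max_degree G = degree G i.
Proof.
move=> n0; have [|i iE] := @bigop.eq_bigmax 'I_n (degree G).
  by rewrite card_ord.
by exists i; rewrite -iE.
Qed.

Lemma min_degree_attained (k n : nat) (G : hypergraph k n) :
  (0 < n)%N -> exists i, min_degree G = degree G i.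
Proof.
move=> n0; have [|i _ iE] := @eq_bigmin _ nat 'I_n #|edges G| (Ordinal n0)
    xpredT (degree G) isT; last by exists i; rewrite -iE.
move=> i _; apply: subset_leq_card.
by apply/fintype.subsetP => e; rewrite inE => /andP[].
Qed.

Lemma degree_gt0 (k n : nat) (G : hypergraph k n) (e : {set 'I_n}) (i : 'I_n) :
  e \in edges G -> i \in e -> (0 < degree G i)%N.
Proof. by move=> eG ie; apply/card_gt0P; exists e; rewrite inE eG. Qed.

Lemma vec_bounds (R : realType) (n : nat) (x : 'cV[R]_n) (j : 'I_n) :
  vec_min x <= x j 0 <= vec_max x.
Proof.
apply/andP; split; first exact: (bigmin_le _ _ (fun i => x i 0)).
exact: (le_bigmax _ (fun i => x i 0)).
Qed.

Lemma vec_min_gt0 (R : realType) (n : nat) (x : 'cV[R]_n) :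
  (0 < n)%N -> (forall i, 0 < x i 0) -> 0 < vec_min x.
Proof.
move=> n0 x0; apply: lt_bigmin => [|i _]; last exact: x0.
exact: lt_le_trans (x0 (Ordinal n0)) (le_bigmax _ (fun i => x i 0) _).
Qed.

(** * The principal ratio *)

Lemma principal_ratio_degree_bounds (R : realType) (k n : nat)
    (G : hypergraph k n) (x : 'cV[R]_n) (i : 'I_n) :
  principal_eigenvector G x ->
  (degree G i)%:R <= spectral_radius R G * principal_ratio x ^+ k.-1 /\
  spectral_radius R G <= (degree G i)%:R * principal_ratio x ^+ k.-1.
Proof.
move=> hx; have [ev x0 _] := hx.
have n0 : (0 < n)%N by apply: leq_ltn_trans (ltn_ord i).
have rho0 : 0 <= spectral_radius R G.
  have [[l _ lr] _] := spectral_radius_max hx.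
  by rewrite -lecR -lr normr_ge0.
rewrite -!(adjacency_row_sum R); apply: eigenvalue_row_sum_bounds => //.
- exact: adjacency_tensor_ge0.
- exact: vec_min_gt0.
- exact: vec_bounds.
- apply: (is_eigenpair_map (f := real_complex R)).
  by rewrite adjacency_tensor_map.
Qed.

Theorem theorem2p1 (R : realType) (k n : nat) (hk : (2 <= k)%N)
    (G : hypergraph k n) (hG : hconnected G) (hE : (0 < #|edges G|)%N)
    (x : 'cV[R]_n) (hx : principal_eigenvector G x) :
  ((max_degree G)%:R / (min_degree G)%:R) `^ ((2 * (k - 1))%:R)^-1
    <= principal_ratio x
  /\ (principal_ratio x =
        ((max_degree G)%:R / (min_degree G)%:R) `^ ((2 * (k - 1))%:R)^-1 ->
      spectral_radius R G =
        Num.sqrt ((max_degree G)%:R * (min_degree G)%:R)).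
Proof.
have [e eG] := card_gt0P hE.
have [v ve] : exists v, v \in e.
  by apply/finset.set0Pn; rewrite -card_gt0 (edges_uniform eG) ltnW.
have n0 : (0 < n)%N by apply: leq_ltn_trans (ltn_ord v).
have [p Dp] := max_degree_attained G n0.
have [q dq] := min_degree_attained G n0.
have [Dle _] := principal_ratio_degree_bounds p hx.
have [_ led] := principal_ratio_degree_bounds q hx.
have D0 : (0 < max_degree G)%N.
  by apply: leq_trans (degree_gt0 eG ve) (leq_bigmax v).
have [_ x0 _] := hx; have m0 := vec_min_gt0 n0 x0.
have g0 : 0 < principal_ratio x.
  have /andP[mx xM] := vec_bounds x v.
  by rewrite divr_gt0// (lt_le_trans (x0 v)).
move: Dle led; rewrite -Dp -dq.
set D : R := (max_degree G)%:R; set d : R := (min_degree G)%:R.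
set rho := spectral_radius R G; set g := principal_ratio x in g0 *.
set a := g ^+ k.-1 => Dle led.
have a0 : 0 < a by rewrite exprn_gt0.
have {}D0 : 0 < D by rewrite ltr0n.
have Dd : D <= d * a ^+ 2.
  by rewrite expr2 mulrA (le_trans Dle)// ler_wpM2r// ltW.
(* Since D > 0, the bounds just obtained force d and rho to be positive; this
   makes the quotient D / d meaningful. *)
have d0 : 0 < d by rewrite -(pmulr_lgt0 _ (exprn_gt0 2 a0)) (lt_le_trans D0).
have rho0 : 0 < rho by rewrite -(pmulr_lgt0 _ a0) (lt_le_trans D0).
have r0 : 0 < D / d by rewrite divr_gt0.
set N := (2 * (k - 1))%N.
have N0 : N%:R != 0 :> R.
  by rewrite pnatr_eq0 -lt0n muln_gt0/= subn_gt0.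
have aN : a ^+ 2 = g ^+ N by rewrite /a -exprM mulnC -subn1.
split.
- have -> : g = (g ^+ N) `^ N%:R^-1.
    by rewrite -powR_mulrn ?(ltW g0)// -powRrM mulfV// powRr1// ltW.
  apply: ge0_ler_powR; rewrite ?nnegrE ?invr_ge0 ?ler0n ?exprn_ge0 ?(ltW g0)
    ?(ltW r0)//.
  by rewrite ler_pdivrMr// mulrC -aN.
- move=> gE.
  have aE : a ^+ 2 = D / d.
    by rewrite aN gE -powR_mulrn ?powR_ge0// -powRrM mulVf// powRr1// ltW.
  have dD : d ^+ 2 * a ^+ 2 = D * d.
    by rewrite aE expr2 -mulrA [d * (D / d)]mulrC divfK ?gt_eqF// mulrC.
  suff rho2 : rho ^+ 2 = D * d by rewrite -rho2 sqrtr_sqr gtr0_norm.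
  apply/eqP; rewrite eq_le -{1}dD -exprMn; apply/andP; split.
    by apply: lerXn2r => //; rewrite nnegrE ltW ?mulr_gt0.
  have : D ^+ 2 <= rho ^+ 2 * a ^+ 2.
    by rewrite -exprMn; apply: lerXn2r => //; rewrite nnegrE ltW ?mulr_gt0.
  by rewrite aE mulrA ler_pdivlMr// expr2 mulrAC ler_pM2r.
Qed.
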